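(* Let $1\le i<j\le m$. For all sufficiently large positive integers $q$, the number $|M((\mathcal{B}_m^{\{x_i-x_j=1\}})_q)|$ of points $(x_1,\dots,x_m)\in\mathbb{Z}_q^m$ with $x_i=x_j+1$ that lie on no hyperplane $H'_q$ with $H'\in\mathcal{B}_m\setminus\{\{x_i-x_j=1\}\}$ equals $$(q-2m)^{m+i-j}(q-2m+1)^{j-i-1}.$$
   Context: For $m\ge1$, the Shi arrangement of type B is the set of affine hyperplanes in $\mathbb{R}^m$ $$\mathcal{B}_m=\{\{x_s=0\},\{x_s=1\}\mid s\in[m]\}\cup\{\{x_s\pm x_t=0\},\{x_s\pm x_t=1\}\mid 1\le s<t\le m\},$$ where $[m]=\{1,\dots,m\}$. For a positive integer $q$ and a hyperplane $H=\{a_1x_1+\dots+a_mx_m=b\}$ with integer coefficients, $H_q=\{x\in\mathbb{Z}_q^m : [a_1]_qx_1+\dots+[a_m]_qx_m=[b]_q\}$ is its reduction modulo $q$, with $\mathbb{Z}_q=\mathbb{Z}/q\mathbb{Z}$. For $H\in\mathcal{B}_m$, the restriction is $\mathcal{B}_m^H=\{H\cap H' : H'\in\mathcal{B}_m\setminus\{H\},\ H\cap H'\neq\emptyset\}$, and $|M((\mathcal{B}_m^H)_q)|$ denotes the number of points of $H_q$ not lying on any $H'_q$ with $H'\in\mathcal{B}_m\setminus\{H\}$ (the characteristic quasi-polynomial of the restriction). *)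

(* Defs.v *)
From mathcomp Require Import all_boot all_order all_algebra.

Set Implicit Arguments.
Unset Strict Implicit.
Unset Printing Implicit Defensive.

Import GRing.Theory.
Local Open Scope ring_scope.

(* (a, b) stands for the hyperplane a_1 x_1 + ... + a_m x_m = b of R^m. It is  *)
(* kept as an integer equation because reduction modulo q depends on the       *)
(* equation and not only on the set of its real points.                        *)
Definition hyperplane (m : nat) : Type := ('rV[int]_m * int)%type.

Definition coord_hyp (m : nat) (s : 'I_m) (b : int) : hyperplane m :=
  (delta_mx 0 s, b).

Definition sum_hyp (m : nat) (s t : 'I_m) (b : int) : hyperplane m :=
  (delta_mx 0 s + delta_mx 0 t, b).

Definition diff_hyp (m : nat) (s t : 'I_m) (b : int) : hyperplane m :=
  (delta_mx 0 s - delta_mx 0 t, b).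

(* In every equation listed the first nonzero coefficient is 1, so different   *)
(* equations define different hyperplanes of R^m. Coordinates are numbered     *)
(* from 0.                                                                     *)
Definition shiB (m : nat) : seq (hyperplane m) :=
  flatten [seq [:: coord_hyp s 0; coord_hyp s 1] | s <- enum 'I_m] ++
  flatten [seq [:: sum_hyp p.1 p.2 0; sum_hyp p.1 p.2 1;
                   diff_hyp p.1 p.2 0; diff_hyp p.1 p.2 1]
          | p <- enum [pred p : 'I_m * 'I_m | (p.1 < p.2)%N]].

(* H_q. Since 'Z_0 and 'Z_1 are both Z/2Z, this is meaningful for q >= 2 only. *)
Definition hyp_mod (m q : nat) (H : hyperplane m) : {set 'rV['Z_q]_m} :=
  [set x : 'rV['Z_q]_m | \sum_(k < m) (H.1 0 k)%:~R * x 0 k == H.2%:~R].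

(* |M((A^H)_q)| *)
Definition card_restr_compl (m q : nat) (A : seq (hyperplane m))
    (H : hyperplane m) : nat :=
  #|hyp_mod q H :\: \bigcup_(H' <- A | H' != H) hyp_mod q H'|.

(* Main.v *)
Require Import Defs.
From mathcomp Require Import all_boot all_order all_algebra.
From mathcomp Require Import zify.

(* List Z_q \ {0, 1} as -1, 2, -2, 3, -3, ... and let u_s < q - 2 be the rank *)
(* of x_s. For both parities of q, x lies on none of the hyperplanes           *)
(* x_s - x_t = 0, x_s + x_t = 0, x_s + x_t = 1 (s <> t) iff the u_s are        *)
(* pairwise at distance at least 2, and then x_s - x_t = 1 iff u_s and u_t     *)
(* have the same parity and differ by 2, u_s being the larger one when odd and *)
(* the smaller one when even. Removing a value u_t (t <> i, j) and lowering    *)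
(* the values above it by 2 preserves all these conditions. Conversely, when a *)
(* label t is inserted into a configuration of n labels with values below N,   *)
(* each label forbids two of the N + 2 positions, and these pairs are disjoint *)
(* except that those of i and j share one position if i < t < j. With          *)
(* q - 2 = G + 2 (m - 1), each insertion therefore contributes a factor G or   *)
(* G + 1, according to whether t lies between i and j, and the pair i, j       *)
(* itself contributes G.                                                       *)

Import GRing.Theory.
Local Open Scope ring_scope.

(** The points become placements of m labels on 0, ..., q - 3, counted by inserting labels one at a
    time. In the list -1, 2, -2, 3, ... the neighbours are the distinct pairs with sum 0 or 1, so
    every condition on x turns into one on the pairwise position of ranks ([code_near], [code_step],
    [card_restr_config]).

    Removing a label t other than i and j and closing a gap of width 2 is undone by insertion
    ([insert_config], [insert_surj]), and the number of places for t does not depend on the smaller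
    configuration ([card_insertable]). The special pair matters only because its two forbidden pairs
    of positions overlap when i < t < j ([corner_adjE]). Multiplying the factors gives
    [card_config], and [prod_between] collects them with G = q - 2m. *)

Definition far (a b : nat) : bool := (a.+1 < b)%N || (b.+1 < a)%N.

(* x_s - x_t = 1 in terms of the ranks a of x_s and b of x_t, when they are    *)
(* [far].                                                                      *)
Definition step (a b : nat) : bool :=
  odd a && (a == b.+2) || ~~ odd a && (b == a.+2).

(** Opening two places rather than one preserves parities, on which [step] depends. *)
Definition shift (v a : nat) : nat := if (v <= a)%N then a.+2 else a.

Definition unshift (v a : nat) : nat := if (v < a)%N then a.-2 else a.

(* With b := below, inserting t at v next to a label of rank a, smaller than t *)
(* iff b holds, is forbidden exactly when v is corner b a or its successor.    *)
Definition corner (below : bool) (a : nat) : nat := (a + (below (+) odd a))%N.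

(** * Pairs of ranks under insertion and removal *)

(** Keeps the link between the parities once they are generalized to arbitrary booleans in the case
    analyses below. *)
Lemma odd_near (a b : nat) : a = b.+2 \/ b = a.+2 -> odd b = odd a.
Proof. by case=> ->; rewrite /= negbK. Qed.

Lemma farC a b : far a b = far b a.
Proof. exact: orbC. Qed.

Lemma shiftK v : cancel (shift v) (unshift v).
Proof. by move=> a; rewrite /unshift /shift; case: ifP; case: ifP; lia. Qed.

Lemma unshiftK v a : far a v -> shift v (unshift v a) = a.
Proof. by rewrite /far /unshift /shift; case: ifP; case: ifP; lia. Qed.

Lemma odd_shift v a : odd (shift v a) = odd a.
Proof. by rewrite /shift; case: ifP => //=; rewrite negbK. Qed.

Lemma odd_unshift v a : far a v -> odd (unshift v a) = odd a.
Proof. by move=> /unshiftK {2}<-; rewrite odd_shift. Qed.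

(** Distances never shrink, so [far] survives and no step appears. A step is lost only if v
    separates two labels at distance 2; since [lb -> la], that v is forbidden by one of them. *)
Lemma shift_compat (a b v : nat) (la lb e : bool) : (lb -> la) ->
  v != corner la a -> v != (corner la a).+1 ->
  v != corner lb b -> v != (corner lb b).+1 ->
  far a b -> step a b = e ->
  far (shift v a) (shift v b) /\ step (shift v a) (shift v b) = e.
Proof.
rewrite /corner /step odd_shift /far /shift; move: (odd_near a b).
move: (odd a) (odd b) => oa ob.
by case: oa; case: ob; case: la; case: lb; rewrite ?addn0 ?addn1 /=;
  case: (leqP v a) => ?; case: (leqP v b) => ?; case: e; lia.
Qed.

(** Removing v can only create a step from v - 2, v, v + 2. Then both consecutive pairs were steps
    in the same direction, and [lb -> la] rules out at least one of them. *)
Lemma unshift_compat (a b v : nat) (la lb e : bool) : (lb -> la) ->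
  far a v -> ~~ (if la then step a v else step v a) ->
  far b v -> ~~ (if lb then step b v else step v b) ->
  far a b -> step a b = e ->
  far (unshift v a) (unshift v b) /\ step (unshift v a) (unshift v b) = e.
Proof.
move=> lab av; move: (odd_near a v) (odd_near b v) (odd_near a b).
rewrite /step odd_unshift //; move: av; rewrite /far /unshift.
move: (odd a) (odd b) (odd v) => oa ob ov.
by move: lab; case: oa; case: ob; case: ov; case: la; case: lb => //=;
  case: (ltnP v a) => ?; case: (ltnP v b) => ?; case: e; lia.
Qed.

(** The position a + 1 is always too near. The positions a and a + 2 put t at distance 2, and
    exactly one of them yields the forbidden orientation of [step]. *)
Lemma avoid_cornerE (a v : nat) (la : bool) :
  (v != corner la a) && (v != (corner la a).+1) =
  far (shift v a) v && ~~ (if la then step (shift v a) v else step v (shift v a)).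
Proof.
move: (odd_near a v) (odd_near (shift v a) v).
rewrite /corner /step odd_shift /far /shift.
have : a = v -> odd a = odd v by move=> ->.
move: (odd a) (odd v) => oa ov.
by case: oa; case: ov; case: la; rewrite ?addn0 ?addn1 /=;
  case: (leqP v a) => ?; lia.
Qed.

Lemma corner_inj (a b : nat) (la lb : bool) :
  (lb -> la) -> far a b -> corner la a != corner lb b.
Proof.
have : a = b.+1 \/ b = a.+1 -> odd b = ~~ odd a.
  by case=> -> /=; rewrite ?negbK.
move: (odd_near a b); rewrite /corner /far; move: (odd a) (odd b) => oa ob.
by case: oa; case: ob; case: la; case: lb; rewrite ?addn0 ?addn1 /=; lia.
Qed.

(** A corner exceeds its label by 0 or 1, so consecutive corners force labels at distance 2, the
    lower one raised and the upper one not. Their parities agree, so [la] and [lb] differ. *)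
Lemma corner_adjE (a b : nat) (la lb : bool) : (lb -> la) -> far a b ->
  (corner la a == (corner lb b).+1) || (corner lb b == (corner la a).+1) =
  [&& la, ~~ lb & step a b].
Proof.
have : a = b.+1 \/ b = a.+1 -> odd b = ~~ odd a.
  by case=> -> /=; rewrite ?negbK.
have : a = b.+3 \/ b = a.+3 -> odd b = ~~ odd a.
  by case=> -> /=; rewrite ?negbK.
move: (odd_near a b); rewrite /corner /step /far; move: (odd a) (odd b) => oa ob.
by case: oa; case: ob; case: la; case: lb; rewrite ?addn0 ?addn1 /=; lia.
Qed.

(** * Configurations on a set of labels *)

Section Configurations.

Variables (m K : nat) (i j : 'I_m).
Hypothesis hij : (i < j)%N.

Definition pos (u : {ffun 'I_m -> 'I_K.+1}) (s : 'I_m) : nat := u s.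

(* Labels outside A take the value 0, so that a configuration on A is counted  *)
(* once.                                                                       *)
Definition config (A : {set 'I_m}) (N : nat) : {set {ffun 'I_m -> 'I_K.+1}} :=
  [set u : {ffun 'I_m -> 'I_K.+1} |
    [forall s, if s \in A then (pos u s < N)%N else u s == ord0] &&
    [forall s in A, forall t in A, (s < t)%N ==>
       far (pos u s) (pos u t) &&
       (step (pos u s) (pos u t) == (s == i) && (t == j))]].

Lemma configP (A : {set 'I_m}) N (u : {ffun 'I_m -> 'I_K.+1}) : reflect
  [/\ forall s, s \in A -> (pos u s < N)%N, forall s, s \notin A -> u s = ord0 &
    forall s t : 'I_m, s \in A -> t \in A -> (s < t)%N ->
      far (pos u s) (pos u t) /\ step (pos u s) (pos u t) = (s == i) && (t == j)]
  (u \in config A N).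
Proof.
rewrite inE; apply: (iffP andP) => [[/forallP h1 /forall_inP h2]|[h1 h2 h3]].
  split=> [s sA|s|s t sA tA st].
  - by have:= h1 s; rewrite sA.
  - by move=> /negPf sA; have:= h1 s; rewrite sA => /eqP.
  - have/forall_inP/(_ t tA) := h2 s sA.
    by rewrite st => /andP[-> /eqP ->].
split; first apply/forallP => s.
  by case: ifPn => sA; [exact: h1 | rewrite h2].
apply/forall_inP => s sA; apply/forall_inP => t tA; apply/implyP => st.
by have [-> ->] := h3 s t sA tA st; rewrite eqxx.
Qed.

(** * Inserting one label *)

Section Insertion.

Variables (A : {set 'I_m}) (t : 'I_m) (n : nat).
Hypotheses (tA : t \notin A) (iA : i \in A) (jA : j \in A) (nK : (n.+1 <= K)%N).

Definition insertable (w : {ffun 'I_m -> 'I_K.+1}) (v : 'I_K.+1) : bool :=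
  (v < n.+2)%N &&
  [forall s in A, ((v : nat) != corner (s < t)%N (pos w s)) &&
                   ((v : nat) != (corner (s < t)%N (pos w s)).+1)].

Definition insert (w : {ffun 'I_m -> 'I_K.+1}) (v : 'I_K.+1) :
    {ffun 'I_m -> 'I_K.+1} :=
  [ffun s => if s == t then v else
             if s \in A then inord (shift v (pos w s)) else ord0].

Lemma neq_insert s : s \in A -> s == t = false.
Proof. by apply: contraTF => /eqP ->. Qed.

Lemma neq_insert_val s : s \in A -> (s : nat) <> t.
Proof. by move=> sA /val_inj st; move: tA; rewrite -st sA. Qed.

(** Shifted values are at most n + 1 <= K, so [inord] never takes its default value. *)
Lemma insertE w v s : w \in config A n -> s \in A ->
  pos (insert w v) s = shift v (pos w s).
Proof.
move=> /configP[h _ _] sA; rewrite /pos ffunE neq_insert // sA inordK //.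
by rewrite -/(pos w s) /shift; have := h s sA; case: ifP; lia.
Qed.

Lemma insert_t w v : pos (insert w v) t = v.
Proof. by rewrite /pos ffunE eqxx. Qed.

Lemma insert_config w v : w \in config A n -> insertable w v ->
  insert w v \in config (t |: A) n.+2.
Proof.
move=> wC /andP[vn /forall_inP hv].
have [w1 w2 w3] := configP _ _ _ wC.
have h s : s \in A -> far (shift v (pos w s)) v /\
    ~~ (if (s < t)%N then step (shift v (pos w s)) v
        else step v (shift v (pos w s))).
  by move=> sA; apply/andP; rewrite -avoid_cornerE hv.
apply/configP; split=> [s|s|s s'].
- rewrite 2!inE => /orP[/eqP ->|sA]; first by rewrite insert_t.
  by rewrite insertE // /shift; have := w1 s sA; case: ifP; lia.
- by rewrite !inE negb_or => /andP[/negPf h1 /negPf h2]; rewrite ffunE h1 h2.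
(* Since i and j lie in A, no pair containing t is the special one, so its [step] must be false. *)
rewrite 2!inE => /orP[/eqP ->|sA]; rewrite 2!inE => /orP[/eqP ->|sA'] ss'.
- by rewrite ltnn in ss'.
- rewrite insert_t insertE // (eq_sym t) (neq_insert _ iA) /=.
  by have := h _ sA'; rewrite (leq_gtF (ltnW ss')) farC => -[-> /negPf].
- rewrite insert_t insertE // (eq_sym t) (neq_insert _ jA) andbF.
  by have := h _ sA; rewrite ss' => -[-> /negPf].
rewrite !insertE //; have [f e] := w3 s s' sA sA' ss'.
have /andP[a1 a2] := hv _ sA; have /andP[b1 b2] := hv _ sA'.
by apply: (shift_compat _ _ _ _ _ _ _ a1 a2 b1 b2 f e); exact: ltn_trans.
Qed.

Lemma insert_surj u : u \in config (t |: A) n.+2 ->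
  exists w v, [/\ w \in config A n, insertable w v & insert w v = u].
Proof.
move=> /configP[u1 u2 u3].
have tU : t \in t |: A by rewrite !inE eqxx.
have AU s : s \in A -> s \in t |: A by rewrite !inE => ->; rewrite orbT.
pose w : {ffun 'I_m -> 'I_K.+1} :=
  [ffun s => if s \in A then inord (unshift (pos u t) (pos u s)) else ord0].
have wE s : s \in A -> pos w s = unshift (pos u t) (pos u s).
  move=> sA; rewrite /pos ffunE sA inordK // -!/(pos u _) /unshift.
  by have : (pos u s < K.+1)%N := ltn_ord (u s); case: ifP; lia.
have h s : s \in A -> far (pos u s) (pos u t) /\
    ~~ (if (s < t)%N then step (pos u s) (pos u t) else step (pos u t) (pos u s)).
  move=> sA; have := neq_insert_val _ sA.
  case: (ltngtP s t) => // st _.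
    have [-> ->] := u3 s t (AU _ sA) tU st.
    by rewrite (eq_sym t) (neq_insert _ jA) andbF.
  have [+ ->] := u3 t s tU (AU _ sA) st.
  by rewrite (eq_sym t) (neq_insert _ iA) farC.
have wC : w \in config A n.
  apply/configP; split=> [s sA|s|s s' sA sA' ss'].
  (* A label below t is at least 2 below it, hence already below n. *)
  - rewrite wE //; have [+ _] := h s sA; rewrite /far /unshift.
    by have := u1 s (AU _ sA); have := u1 t tU; case: ifP; lia.
  - by rewrite ffunE => /negPf ->.
  rewrite !wE //; have [f e] := u3 s s' (AU _ sA) (AU _ sA') ss'.
  have [a1 a2] := h s sA; have [b1 b2] := h s' sA'.
  by apply: (unshift_compat _ _ _ _ _ _ _ a1 a2 b1 b2 f e); exact: ltn_trans.
exists w, (u t); split=> //.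
  apply/andP; split; first exact: (u1 t tU).
  apply/forall_inP => s sA; have [h1 h2] := h s sA.
  by rewrite avoid_cornerE wE // unshiftK // h1.
apply/ffunP => s; apply/val_inj; rewrite /= -/(pos _ s) -/(pos u s).
have [->|st] := eqVneq s t; first by rewrite insert_t.
have [sA|sA] := boolP (s \in A); last first.
  by rewrite /pos ffunE (negPf st) (negPf sA) u2 // !inE negb_or st.
by rewrite insertE // wE // unshiftK //; case: (h s sA).
Qed.

Lemma insert_inj w w' v v' : w \in config A n -> w' \in config A n ->
  insert w v = insert w' v' -> w = w' /\ v = v'.
Proof.
move=> wC wC' e.
have ev : v = v' by apply/val_inj; rewrite /= -(insert_t w v) e insert_t.
split=> //; subst v'; apply/ffunP => s; apply/val_inj.
rewrite /= -/(pos w s) -/(pos w' s).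
have [sA|sA] := boolP (s \in A); last first.
  by rewrite /pos; case/configP: wC => _ -> //; case/configP: wC' => _ ->.
by have := congr1 (pos^~ s) e; rewrite !insertE // => /(can_inj (shiftK v)).
Qed.

(** Inclusion-exclusion for the forbidden positions: [E1] holds the corners and [E2] their
    successors, each of size #|A|. *)
Lemma card_insertable w : w \in config A n ->
  (#|[set v | insertable w v]| + 2 * #|A| = n.+2 + (i < t < j))%N.
Proof.
move=> wC; have [w1 _ w3] := configP _ _ _ wC.
pose c (s : 'I_m) : nat := corner (s < t)%N (pos w s).
pose E1 : {set 'I_K.+1} := [set inord (c s) | s in A].
pose E2 : {set 'I_K.+1} := [set inord (c s).+1 | s in A].
(* Hence both forbidden positions of every label fall among the n + 2 available ones. *)
have cle s : s \in A -> (c s <= n)%N.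
  by move=> sA; rewrite /c /corner; have := w1 s sA; lia.
have cK s : s \in A -> (inord (c s) : 'I_K.+1) = c s :> nat.
  by move=> sA; rewrite inordK //; have := cle s sA; lia.
have cSK s : s \in A -> (inord (c s).+1 : 'I_K.+1) = (c s).+1 :> nat.
  by move=> sA; rewrite inordK //; have := cle s sA; lia.
have mE1 s : s \in A -> inord (c s) \in E1.
  by move=> sA; apply/imsetP; exists s.
have mE2 s : s \in A -> inord (c s).+1 \in E2.
  by move=> sA; apply/imsetP; exists s.
have lt_mono s s' : (s < s')%N -> (s' < t)%N -> (s < t)%N.
  exact: ltn_trans.
have inj : {in A &, injective c}.
  move=> s s' sA sA' e.
  have [lt|lt|/val_inj //] := ltngtP s s'.
    have [f _] := w3 _ _ sA sA' lt.
    by have := corner_inj _ _ _ _ (lt_mono _ _ lt) f; rewrite -!/(c _) e eqxx.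
  have [f _] := w3 _ _ sA' sA lt.
  by have := corner_inj _ _ _ _ (lt_mono _ _ lt) f; rewrite -!/(c _) e eqxx.
have adj s s' : s \in A -> s' \in A -> (s < s')%N ->
    (c s == (c s').+1) || (c s' == (c s).+1) ->
    [/\ s = i, s' = j & (i < t < j)%N].
  move=> sA sA' lt; have [f e] := w3 _ _ sA sA' lt.
  rewrite corner_adjE // => [|/(ltn_trans lt) //]; rewrite e.
  case/and3P => st s't /andP[/eqP ei /eqP ej]; split=> //; move: st s't.
  have := neq_insert_val _ sA'; rewrite ei ej; lia.
have c1 : #|E1| = #|A|.
  apply: card_in_imset => s s' sA sA' /(congr1 val) /=.
  by rewrite !cK //; exact: inj.
have c2 : #|E2| = #|A|.
  apply: card_in_imset => s s' sA sA' /(congr1 val) /=.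
  by rewrite !cSK // => -[]; exact: inj.
(* A common element comes from two consecutive corners, which [adj] attributes to i and j; it is the
   larger corner. *)
have c12 : #|E1 :&: E2| = (i < t < j)%N.
  have mem12 v : v \in E1 :&: E2 -> (i < t < j)%N /\
      (v = maxn (c i) (c j) :> nat).
    rewrite inE => /andP[/imsetP[s sA ->] /imsetP[s' sA' /(congr1 val)]] /=.
    rewrite cK // cSK // => e; case: (ltngtP s s') => [lt|lt|/val_inj ss'].
    - have [|<- <- ->] := adj _ _ sA sA' lt; first by rewrite e eqxx.
      by split=> //; lia.
    - have [|<- <- ->] := adj _ _ sA' sA lt; first by rewrite e eqxx orbT.
      by split=> //; lia.
    - by move: e; rewrite ss'; lia.
  have [mid|nmid] := boolP (i < t < j)%N; last first.
    apply/eqP; rewrite cards_eq0 -subset0; apply/subsetP => v /mem12[].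
    by rewrite (negPf nmid).
  have [f e] := w3 _ _ iA jA hij; case/andP: mid => it tj.
  have : (c i == (c j).+1) || (c j == (c i).+1).
    by rewrite corner_adjE // e it -leqNgt (ltnW tj) !eqxx.
  move=> cij.
  have -> : E1 :&: E2 = [set inord (maxn (c i) (c j))].
    apply/eqP; rewrite eqEsubset sub1set inE; apply/andP; split.
      by apply/subsetP => v /mem12[_ <-]; rewrite inord_val inE.
    have /orP[] : (maxn (c i) (c j) == c i) && (c i == (c j).+1) ||
           (maxn (c i) (c j) == c j) && (c j == (c i).+1) by lia.
      by case/andP=> /eqP -> /eqP e'; rewrite mE1 // e' mE2.
    by case/andP=> /eqP -> /eqP e'; rewrite mE1 // e' mE2.
  by rewrite cards1.
pose V : {set 'I_K.+1} := [set v : 'I_K.+1 | (v < n.+2)%N].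
have cV : #|V| = n.+2.
  have nK2 : (n.+2 <= K.+1)%N by [].
  have -> : V = [set widen_ord nK2 x | x in 'I_n.+2].
    apply/setP => v; rewrite inE; apply/idP/imsetP => [h|[x _ ->]]; last exact: (valP x).
    by exists (Ordinal h) => //; apply/val_inj.
  by rewrite card_imset ?card_ord // => x y /(congr1 val) /= /val_inj.
have EV : E1 :|: E2 \subset V.
  apply/subsetP => v; rewrite !inE => /orP[] /imsetP[s sA ->].
    by rewrite cK //; have := cle _ sA; lia.
  by rewrite cSK //; have := cle _ sA; lia.
have -> : [set v | insertable w v] = V :\: (E1 :|: E2).
  apply/setP => v; rewrite !inE andbC; congr (_ && _).
  apply/forall_inP/norP => [h|[h1 h2] s sA].
    split; apply/negP => /imsetP[s sA e]; have := h s sA; rewrite e.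
      by rewrite cK ?eqxx.
    by rewrite cSK ?eqxx ?andbF.
  apply/andP; split.
    apply: contra h1 => /eqP e; apply/imsetP; exists s => //.
    by apply/val_inj; rewrite /= cK.
  apply: contra h2 => /eqP e; apply/imsetP; exists s => //.
  by apply/val_inj; rewrite /= cSK.
have := cardsU E1 E2; have := subset_leq_card EV; have := subset_leq_card (subsetIl E1 E2).
rewrite cardsD (setIidPr EV) c1 c2 c12 cV.
by move: #|E1 :|: E2| #|A| (nat_of_bool _) => x y z; lia.
Qed.

(** Configurations on t |: A correspond to pairs of a configuration on A and an insertable place,
    and all fibres have the same size. *)
Lemma card_config_insert G : n = (G + 2 * (#|A|).-1)%N ->
  #|config (t |: A) n.+2| = (#|config A n| * (G + (i < t < j)%N))%N.
Proof.
move=> en.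
pose P := [set p : {ffun 'I_m -> 'I_K.+1} * 'I_K.+1 |
             (p.1 \in config A n) && insertable p.1 p.2].
have PE p : (p \in P) = (p.1 \in config A n) && insertable p.1 p.2 by rewrite in_set.
have -> : config (t |: A) n.+2 = [set insert p.1 p.2 | p in P].
  apply/setP => u; apply/idP/imsetP => [/insert_surj[w [v [h1 h2 h3]]]|[[w v]]].
    by exists (w, v); rewrite // PE h1.
  by rewrite PE /= => /andP[h1 h2] ->; exact: insert_config.
rewrite card_in_imset; last first.
  move=> [w v] [w' v']; rewrite !PE /= => /andP[a1 _] /andP[b1 _] e.
  by have [-> ->] := insert_inj _ _ _ _ a1 b1 e.
rewrite -sum1_card.
rewrite (eq_bigl _ _ PE).
rewrite -(pair_big_dep (fun w => w \in config A n) insertable (fun _ _ => 1%N)) /=.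
rewrite -sum_nat_const; apply: eq_bigr => w wC; rewrite sum1dep_card.
have := card_insertable _ wC.
have : (0 < #|A|)%N by apply/card_gt0P; exists i.
by rewrite en; lia.
Qed.

End Insertion.

(** * Counting configurations by induction on the labels *)

(** The smaller of the two values ranges over 0, ..., G - 1; its parity decides which of i and j
    takes it. *)
Lemma card_config_pair G : (G < K)%N -> #|config [set i; j] G.+2| = G.
Proof.
move=> GK.
pose f (a : 'I_G) : {ffun 'I_m -> 'I_K.+1} :=
  [ffun s => if s == i then inord (if odd a then a.+2 else a : nat)
             else if s == j then inord (if odd a then a : nat else a.+2) else ord0].
have ji : j == i = false by rewrite -val_eqE eqn_leq leqNgt hij.
have fi a : pos (f a) i = (if odd a then a.+2 else a : nat).
  by rewrite /pos ffunE eqxx inordK //; have := ltn_ord a; case: ifP; lia.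
have fj a : pos (f a) j = (if odd a then a : nat else a.+2).
  by rewrite /pos ffunE ji eqxx inordK //; have := ltn_ord a; case: ifP; lia.
rewrite -[RHS]card_ord -(card_imset (f := f)); last first.
  move=> a b e; apply/val_inj => /=.
  by have := congr1 (pos^~ i) e; have := congr1 (pos^~ j) e; rewrite !fi !fj;
    do 2 case: ifP; lia.
apply: eq_card => u; apply/configP/imsetP => [[u1 u2 u3]|[a _ ->]].
  have iI : i \in [set i; j] by rewrite !inE eqxx.
  have jI : j \in [set i; j] by rewrite !inE eqxx orbT.
  have [_] := u3 i j iI jI hij; rewrite !eqxx /step => st.
  have ui := u1 i iI; have uj := u1 j jI.
  have aG : (minn (pos u i) (pos u j) < G)%N by case/orP: st; lia.
  exists (Ordinal aG) => //; apply/ffunP => s; apply/val_inj.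
  rewrite /= -/(pos u s) -/(pos (f _) s).
  have [->|si] := eqVneq s i.
    rewrite fi /=; case/orP: st => /andP[o /eqP e].
      have -> : minn (pos u i) (pos u j) = pos u j by lia.
      by move: o; rewrite e /= negbK => ->.
    have -> : minn (pos u i) (pos u j) = pos u i by lia.
    by rewrite (negPf o).
  have [->|sj] := eqVneq s j.
    rewrite fj /=; case/orP: st => /andP[o /eqP e].
      have -> : minn (pos u i) (pos u j) = pos u j by lia.
      by move: o; rewrite e /= negbK => ->.
    have -> : minn (pos u i) (pos u j) = pos u i by lia.
    by rewrite (negPf o).
  by rewrite /pos u2 ?ffunE ?(negPf si) ?(negPf sj) // !inE negb_or si.
split=> [s|s|s t].
- by rewrite !inE => /orP[]/eqP->; rewrite ?fi ?fj; have := ltn_ord a; case: ifP; lia.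
- by rewrite !inE negb_or => /andP[/negPf h1 /negPf h2]; rewrite ffunE h1 h2.
rewrite !inE => /orP[]/eqP-> /orP[]/eqP-> st; rewrite ?ltnn // in st.
  rewrite fi fj !eqxx /far /step; case: ifP => /= o; rewrite ?negbK o ?eqxx; split=> //; lia.
by move: st; rewrite ltnNge ltnW.
Qed.

(** Writing the number of positions as G + 2 (#|A| - 1) keeps G fixed when a label and two positions
    are removed together. The index i carries the factor G of the initial pair. *)
Lemma card_config G (A : {set 'I_m}) : i \in A -> j \in A ->
  (G + 2 * #|A|.-1 <= K.+1)%N ->
  #|config A (G + 2 * #|A|.-1)| = (\prod_(t in A :\ j) (G + (i < t < j)))%N.
Proof.
have ij : i != j by rewrite -val_eqE neq_ltn hij.
elim: {A}#|A| {-2}A (erefl #|A|) => [A /eqP|n IHn A cA iA jA hK].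
  by rewrite cards_eq0 => /eqP ->; rewrite inE.
have [/subsetP sA|] := boolP (A \subset [set i; j]).
  have eA : A = [set i; j].
    apply/eqP; rewrite eqEsubset; apply/andP; split; first exact/subsetP.
    by apply/subsetP => s; rewrite !inE => /orP[]/eqP ->.
  move: hK; rewrite eA cards2 ij /= muln1 addn2 => hK.
  rewrite card_config_pair //.
  have -> : [set i; j] :\ j = [set i].
    apply/setP => s; rewrite !inE; have [->|] := eqVneq s j => //=.
      by rewrite eq_sym (negPf ij).
    by rewrite orbF.
  by rewrite big_set1 ltnn addn0.
case/subsetPn => t tA; rewrite !inE negb_or => /andP[ti tj].
pose B := A :\ t.
have eA : A = t |: B by rewrite setD1K.
have tB : t \notin B by rewrite !inE eqxx.
have iB : i \in B by rewrite !inE eq_sym ti.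
have jB : j \in B by rewrite !inE eq_sym tj.
have cB : #|B| = n by move: cA; rewrite eA cardsU1 tB; lia.
have n0 : (0 < n)%N by rewrite -cB; apply/card_gt0P; exists i.
move: hK; rewrite cA /= => hK.
have -> : (G + 2 * n = (G + 2 * n.-1).+2)%N by lia.
rewrite eA (card_config_insert _ _ _ tB iB jB _ G) ?cB //; last by lia.
have := IHn B cB iB jB; rewrite cB => ->; last by lia.
rewrite mulnC [RHS](bigD1 t) /=; last by rewrite !inE tj eqxx.
congr (_ * _)%N; apply: eq_bigl => s; rewrite !inE.
by have [->|] := eqVneq s t; rewrite ?andbF ?andbT.
Qed.

Lemma card_between : #|[pred t : 'I_m | (i < t < j)%N]| = (j - i - 1)%N.
Proof.
rewrite -sum1_card -subnDA addn1 -[RHS]muln1 -sum_nat_const_nat.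
rewrite (@big_nat_widen _ _ _ _ j m) ?(ltnW (ltn_ord j)) // big_geq_mkord.
by apply: eq_bigl => t; rewrite inE /= andbC.
Qed.

Lemma prod_between G :
  (\prod_(t in [set: 'I_m] :\ j) (G + (i < t < j)) =
   G ^ (m + i - j) * G.+1 ^ (j - i - 1))%N.
Proof.
rewrite (bigID [pred t : 'I_m | (i < t < j)%N]) /= mulnC; congr (_ * _)%N.
  rewrite (eq_bigr (fun _ => G)) => [|t /andP[_ /negPf ->]]; last by rewrite addn0.
  rewrite prod_nat_const; congr (_ ^ _)%N.
  have e : (#|[pred t : 'I_m | (i < t < j)%N]| +
            #|[pred t in [set: 'I_m] :\ j | ~~ (i < t < j)%N]| + 1)%N = m.
    rewrite -[RHS]card_ord -(cardC (pred1 j)) card1 addnC; congr (_ + _)%N.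
    rewrite -(cardID [pred t : 'I_m | (i < t < j)%N] (predC (pred1 j))).
    congr (_ + _)%N; apply: eq_card => t; rewrite !inE ?andbT 1?andbC //.
    by case: eqVneq => [->|]; rewrite ?ltnn ?andbF ?andbT.
  by move: e; rewrite card_between; move: #|_| (ltn_ord j) => c; lia.
rewrite (eq_bigr (fun _ => G.+1)) => [|t /andP[_ ->]]; last by rewrite addn1.
rewrite prod_nat_const -card_between; congr (_ ^ _)%N; apply: eq_card => t.
by rewrite !inE unfold_in !inE andbT; case: (eqVneq t j) => [->|]; rewrite ?ltnn ?andbF /=.
Qed.

End Configurations.

(** * Encoding residues by ranks *)

(* The rank of x in -1, 2, -2, 3, -3, ...; junk for x = 0, 1.                  *)
Definition code (q x : nat) : nat :=
  if (2 * x <= q)%N then (2 * x - 3)%N else (2 * (q - x) - 2)%N.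

Lemma code_lt (q x : nat) : (1 < x < q)%N -> (code q x < q - 2)%N.
Proof. by rewrite /code; case: ifP; lia. Qed.

Lemma code_near (q x y : nat) : (1 < x < q)%N -> (1 < y < q)%N ->
  far (code q x) (code q y) = ~~ [|| x == y, x + y == q | x + y == q.+1]%N.
Proof. by rewrite /code /far; case: ifP; case: ifP; lia. Qed.

(** Odd ranks list 2, 3, ... and even ranks -1, -2, ..., whence the two orientations of [step]. The
    pair x = y + 1 straddling the two halves has sum q or q + 1 and is excluded by [far]. *)
Lemma code_step (q x y : nat) : (1 < x < q)%N -> (1 < y < q)%N ->
  far (code q x) (code q y) -> step (code q x) (code q y) = (x == y.+1).
Proof.
move=> hx hy; rewrite code_near // /step.
have -> : odd (code q x) = (2 * x <= q)%N.
  rewrite /code; case: ifP => h.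
    have -> : (2 * x - 3 = (2 * (x - 2)).+1)%N by lia.
    by rewrite /= oddM.
  have -> : (2 * (q - x) - 2 = 2 * (q - x - 1))%N by lia.
  by rewrite oddM.
by rewrite /code; case: ifP; case: ifP; lia.
Qed.

Definition decode (q c : nat) : nat :=
  if odd c then (c./2 + 2)%N else (q - c./2 - 1)%N.

Lemma decode_bounds (q c : nat) : (c < q - 2)%N -> (1 < decode q c < q)%N.
Proof.
by rewrite /decode => hc; have := odd_double_half c; case: ifP; lia.
Qed.

Lemma decodeK (q c : nat) : (c < q - 2)%N -> code q (decode q c) = c.
Proof.
move=> hc; have := odd_double_half c; rewrite /decode /code.
by case: ifP; case: ifP; lia.
Qed.

Lemma code_inj (q x y : nat) : (1 < x < q)%N -> (1 < y < q)%N ->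
  code q x = code q y -> x = y.
Proof. by rewrite /code; case: ifP; case: ifP; lia. Qed.

(** * Hyperplanes modulo q and the restricted complement *)

Lemma sum_delta (R : nzRingType) (m : nat) (s : 'I_m) (x : 'rV[R]_m) :
  \sum_(k < m) ((delta_mx 0 s : 'rV[int]_m) 0 k)%:~R * x 0 k = x 0 s.
Proof.
rewrite (bigD1 s) //= mxE !eqxx mul1r big1 ?addr0 // => k ks.
by rewrite mxE (negPf ks) andbF mul0r.
Qed.

Lemma mem_coord_hyp (m q : nat) (s : 'I_m) b (x : 'rV['Z_q]_m) :
  (x \in hyp_mod q (coord_hyp s b)) = (x 0 s == b%:~R).
Proof. by rewrite inE /= sum_delta. Qed.

Lemma mem_sum_hyp (m q : nat) (s t : 'I_m) b (x : 'rV['Z_q]_m) :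
  (x \in hyp_mod q (sum_hyp s t b)) = (x 0 s + x 0 t == b%:~R).
Proof.
rewrite inE /= -(sum_delta _ _ s x) -(sum_delta _ _ t x) -big_split /=.
by congr (_ == _); apply: eq_bigr => k _; rewrite -mulrDl -rmorphD !mxE.
Qed.

Lemma mem_diff_hyp (m q : nat) (s t : 'I_m) b (x : 'rV['Z_q]_m) :
  (x \in hyp_mod q (diff_hyp s t b)) = (x 0 s - x 0 t == b%:~R).
Proof.
rewrite inE /= -(sum_delta _ _ s x) -(sum_delta _ _ t x) -sumrB /=.
by congr (_ == _); apply: eq_bigr => k _; rewrite -mulrBl -rmorphB !mxE.
Qed.

(** The coefficient of index j is -1 on the right and nonnegative on the left. *)
Lemma sum_diff_neq (m : nat) (s t i j : 'I_m) b c : (i < j)%N ->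
  sum_hyp s t b != diff_hyp i j c.
Proof.
move=> ij; apply/eqP => -[/matrixP/(_ 0 j)]; rewrite !mxE !eqxx /=.
have -> : j == i = false by rewrite -val_eqE eqn_leq leqNgt ij.
by case: (j == s); case: (j == t).
Qed.

Lemma coord_diff_neq (m : nat) (s i j : 'I_m) b c : (i < j)%N ->
  coord_hyp s b != diff_hyp i j c.
Proof.
move=> ij; apply/eqP => -[/matrixP/(_ 0 j)]; rewrite !mxE !eqxx /=.
have -> : j == i = false by rewrite -val_eqE eqn_leq leqNgt ij.
by case: (j == s).
Qed.

Lemma diff_hyp_inj (m : nat) (s t i j : 'I_m) b c : (i < j)%N ->
  diff_hyp s t b = diff_hyp i j c -> [/\ s = i, t = j & b = c].
Proof.
move=> ij [/matrixP e ->].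
have ji : j == i = false by rewrite -val_eqE eqn_leq leqNgt ij.
have := e 0 j; have := e 0 i; rewrite !mxE !eqxx /= (eq_sym i j) ji.
case: (eqVneq i s) => [<-|_]; last by case: (i == t).
by rewrite ji; case: (eqVneq j t) => [<-|].
Qed.

Lemma mem_shiBP (m : nat) (P : hyperplane m -> Prop) :
  (forall H, H \in shiB m -> P H) <->
  (forall s, P (coord_hyp s 0) /\ P (coord_hyp s 1)) /\
  (forall s t : 'I_m, (s < t)%N ->
     [/\ P (sum_hyp s t 0), P (sum_hyp s t 1), P (diff_hyp s t 0) & P (diff_hyp s t 1)]).
Proof.
split=> [h|[h1 h2] H].
  split=> [s|s t st].
    split; apply: h; rewrite mem_cat; apply/orP; left; apply/flatten_mapP;
    by exists s; rewrite ?mem_enum // !inE eqxx ?orbT.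
  split; apply: h; rewrite mem_cat; apply/orP; right; apply/flatten_mapP;
  by exists (s, t); rewrite ?mem_enum // !inE eqxx ?orbT.
rewrite mem_cat => /orP[] /flatten_mapP[].
  by move=> s _; rewrite !inE => /orP[] /eqP ->; case: (h1 s).
move=> [s t]; rewrite mem_enum inE /= => /h2[p1 p2 p3 p4].
by rewrite !inE => /or4P[] /eqP ->.
Qed.

Lemma notin_bigcup_seqP (T : finType) (I : eqType) (r : seq I) (P : pred I)
    (F : I -> {set T}) x :
  reflect (forall y, y \in r -> P y -> x \notin F y)
    (x \notin \bigcup_(y <- r | P y) F y).
Proof.
elim: r => [|y r IHr]; first by rewrite big_nil inE; apply: ReflectT.
have -> : (x \notin \bigcup_(z <- y :: r | P z) F z) =
    (P y ==> (x \notin F y)) && (x \notin \bigcup_(z <- r | P z) F z).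
  by rewrite big_cons; case: (P y); rewrite ?inE ?negb_or.
apply: (iffP andP) => [[/implyP h /IHr hr] z|h].
  by rewrite inE => /orP[/eqP -> //|]; exact: hr.
split; first by apply/implyP; apply: h; rewrite inE eqxx.
by apply/IHr => z zr; apply: h; rewrite inE zr orbT.
Qed.

(** The equation of the restricting hyperplane and the inequations for all other x_s - x_t = 1 merge
    into one boolean identity, the form used in [config]. *)
Lemma restr_complP (m q : nat) (i j : 'I_m) (x : 'rV['Z_q]_m) : (i < j)%N ->
  reflect ((forall s, x 0 s != 0 /\ x 0 s != 1) /\
    (forall s t : 'I_m, (s < t)%N ->
      [/\ x 0 s + x 0 t != 0, x 0 s + x 0 t != 1, x 0 s != x 0 t &
          (x 0 s - x 0 t == 1) = (s == i) && (t == j)]))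
  (x \in hyp_mod q (diff_hyp i j 1) :\:
     \bigcup_(H <- shiB m | H != diff_hyp i j 1) hyp_mod q H).
Proof.
move=> ij; rewrite inE mem_diff_hyp.
pose P H := H != diff_hyp i j 1 -> x \notin hyp_mod q H.
apply: (iffP andP) => [[/notin_bigcup_seqP h xij]|[h1 h2]].
  have [h1 h2] := (mem_shiBP m P).1 h.
  split=> [s|s t st].
    have [+ +] := h1 s; rewrite /P !mem_coord_hyp => c0 c1.
    by split; [apply: c0 | apply: c1]; exact: coord_diff_neq.
  have [s0 s1 d0 d1] := h2 s t st.
  split.
  - by have := s0 (sum_diff_neq _ _ _ _ _ _ _ ij); rewrite mem_sum_hyp.
  - by have := s1 (sum_diff_neq _ _ _ _ _ _ _ ij); rewrite mem_sum_hyp.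
  - have := d0; rewrite /P mem_diff_hyp subr_eq0; apply.
    by apply/eqP => /(diff_hyp_inj _ _ _ _ _ _ _ ij)[].
  case: andP => [[/eqP -> /eqP ->] //|nij].
  apply/negbTE; have := d1; rewrite /P mem_diff_hyp; apply.
  by apply/eqP => /(diff_hyp_inj _ _ _ _ _ _ _ ij)[es et _]; apply: nij;
    rewrite es et !eqxx.
split; last by have [_ _ _ ->] := h2 i j ij; rewrite !eqxx.
apply/notin_bigcup_seqP; apply/(mem_shiBP m P); split=> [s|s t st].
  by have [c0 c1] := h1 s; split=> _; rewrite mem_coord_hyp.
have [a0 a1 d0 d1] := h2 s t st; split=> ne; rewrite ?mem_sum_hyp ?mem_diff_hyp //.
  by rewrite subr_eq0.
rewrite d1; apply: contra ne => /andP[/eqP -> /eqP ->]; exact: eqxx.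
Qed.

(** * From points to configurations, and the final count *)

Lemma card_restr_config (m n : nat) (i j : 'I_m) : (i < j)%N ->
  card_restr_compl n.+2 (shiB m) (diff_hyp i j 1) = #|config m n.+1 i j setT n|.
Proof.
move=> ij; pose q := n.+2.
pose val_lt (a : 'Z_q) : (a < q)%N := ltn_ord a.
have e0 (a : 'Z_q) : (a == 0) = ((a : nat) == 0)%N by [].
have e1 (a : 'Z_q) : (a == 1) = ((a : nat) == 1)%N by [].
have mod_lt k : (k < q + q)%N -> (k %% q = if (k < q)%N then k else (k - q)%N)%N.
  move=> kq; case: ltnP => h; first by rewrite modn_small.
  by rewrite -{1}(subnK h) modnDr modn_small //; lia.
have addE (a b : 'Z_q) : (a + b : 'Z_q) =
      (if (a + b < q)%N then (a + b)%N else (a + b - q)%N) :> nat.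
  by rewrite -mod_lt //; have := val_lt a; have := val_lt b; lia.
(* Representatives above 1 exclude the sums 0 and 1 as integers, leaving only the values q and q +
   1; they also exclude wraparound in [diff1]. *)
have sum0 (a b : 'Z_q) : (1 < a)%N -> (a + b == 0) = (a + b == q)%N.
  by move=> a1; rewrite e0 addE; have := val_lt a; have := val_lt b; case: ifP; lia.
have sum1 (a b : 'Z_q) : (1 < a)%N -> (a + b == 1) = (a + b == q.+1)%N.
  by move=> a1; rewrite e1 addE; have := val_lt a; have := val_lt b; case: ifP; lia.
have diff1 (a b : 'Z_q) : (1 < a)%N -> (a - b == 1) = (a == b.+1 :> nat).
  move=> a1; rewrite subr_eq.
  have -> : (a == 1 + b) = (a == (1 + b : 'Z_q) :> nat) by [].
  rewrite addE (_ : (1 : 'Z_q) = 1%N :> nat) //.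
  by have := val_lt a; have := val_lt b; case: ifP; rewrite /=; lia.
pose f (x : 'rV['Z_q]_m) : {ffun 'I_m -> 'I_n.+2} :=
  [ffun s => inord (code q (x 0 s))].
have fE (x : 'rV['Z_q]_m) s : (1 < x 0%R s < q)%N -> pos m n.+1 (f x) s =
      code q (x 0 s).
  by move=> xq; rewrite /pos ffunE inordK //; have := code_lt q _ xq; lia.
have bounds (a : 'Z_q) : a != 0 /\ a != 1 -> (1 < a < q)%N.
  by rewrite e0 e1 val_lt => -[]; lia.
rewrite /card_restr_compl -(card_in_imset (f := f)); last first.
  move=> x y /(restr_complP _ _ _ _ _ ij)[hx _] /(restr_complP _ _ _ _ _ ij)[hy _] e.
  apply/matrixP => r s; rewrite ord1; apply/val_inj.
  have xs := bounds _ (hx s); have ys := bounds _ (hy s).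
  by apply: (code_inj q) => //; rewrite -!fE // e.
apply: eq_card => u; apply/imsetP/configP.
  case=> x /(restr_complP _ _ _ _ _ ij)[/(_ _)/bounds hx hd] ->.
  split=> [s _|s|s t _ _ st]; rewrite ?inE // ?fE //.
    by have := code_lt q _ (hx s); lia.
  have [h1 h2 h3 h4] := hd s t st.
  have [/andP[xs _] /andP[xt _]] := (hx s, hx t).
  have far_st : far (code q (x 0 s)) (code q (x 0 t)).
    by rewrite code_near // -sum0 // -sum1 // !negb_or h1 h2 h3.
  by split=> //; rewrite code_step // -diff1.
case=> u1 _ u3; pose x : 'rV['Z_q]_m := \row_s inord (decode q (pos m n.+1 u s)).
have lt_u s : (pos m n.+1 u s < q - 2)%N.
  by have := u1 s (in_setT s); lia.
have xE s : x 0 s = decode q (pos m n.+1 u s) :> nat.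
  by rewrite mxE inordK //; case/andP: (decode_bounds _ _ (lt_u s)).
have hx s : (1 < x 0%R s < q)%N by rewrite xE decode_bounds.
exists x; last first.
  apply/ffunP => s; apply/val_inj; rewrite /= -/(pos m n.+1 u s) -/(pos m n.+1 (f x) s).
  by rewrite fE // xE decodeK.
apply/(restr_complP _ _ _ _ _ ij); split=> [s|s t st].
  by rewrite e0 e1; have := hx s; lia.
have [] := u3 s t (in_setT s) (in_setT t) st.
have cE r : pos m n.+1 u r = code q (x 0 r) by rewrite xE decodeK.
have [/andP[xs _] /andP[xt _]] := (hx s, hx t).
rewrite !cE => far_st; rewrite code_step // -diff1 // => ->.
by move: far_st; rewrite code_near // -sum0 // -sum1 // !negb_or => /and3P[-> -> ->].
Qed.

Lemma PoszX (a k : nat) : Posz (a ^ k) = Posz a ^+ k.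
Proof. by elim: k => // k IHk; rewrite expnS exprS PoszM IHk. Qed.

Theorem theorem6p1 (m : nat) (i j : 'I_m) (hij : (i < j)%N) :
  exists q0 : nat, forall q : nat, (1 < q)%N -> (q0 <= q)%N ->
    (card_restr_compl q (shiB m) (diff_hyp i j 1))%:Z =
    (q%:Z - (2 * m)%:Z) ^+ (m + i - j) *
    (q%:Z - (2 * m)%:Z + 1) ^+ (j - i - 1).
Proof.
(* From q = 2m on, G = q - 2m is a natural number and q - 2 = G + 2 (m - 1). *)
exists (2 * m)%N => -[//|[//|n]] _ mq; have jm := ltn_ord j.
have cT : #|[set: 'I_m]| = m by rewrite cardsT card_ord.
have := card_config m n.+1 i j hij (n.+2 - 2 * m) setT (in_setT _) (in_setT _).
rewrite cT (_ : (n.+2 - 2 * m + 2 * m.-1)%N = n); last by lia.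
rewrite card_restr_config // => ->; last by lia.
by rewrite prod_between // PoszM !PoszX (subzn mq) (intS (n.+2 - 2 * m)) [1 + _]addrC.
Qed.
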